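(* Let $0\leqslant\beta<1$ and $\alpha=1$, and consider the difference equation $x_{n+1}=1+\beta x_{n-1}+\frac{x_{n-1}}{x_n}$ with positive initial conditions, together with its associated planar map $T(y,z)=\left(z,\ 1+\beta y+\frac yz\right)$ on $(0,\infty)^2$. Let $\Phi>\frac{1}{1-\beta}$ and $\Psi=\frac{\Phi}{(1-\beta)\Phi-1}$, with $\Phi\neq\Psi$. Define $$c_2(\Phi)=\frac{\Phi}{(1-\Phi)(\Phi+\Psi-1)(2\Phi\Psi-\Phi-\Psi+1)},\qquad c_3(\Phi)=\frac{\Phi^4\kappa_1+\Phi^3\kappa_2-\Phi^2\kappa_3+\Phi\kappa_4}{\Psi(\Psi+\Phi-1)(1-\Phi)\kappa_5}\,c_2(\Phi),$$ where $$\kappa_1=3\Psi^2-4\Psi+1,\quad \kappa_2=3\Psi^3-12\Psi^2+9\Psi-1,\quad \kappa_3=5\Psi^3-14\Psi^2+6\Psi+1,$$ $$\kappa_4=2\Psi^3-4\Psi^2+\Psi+1,\quad \kappa_5=\Phi^2(3\Psi^2-3\Psi+1)-\Phi(3\Psi^2-5\Psi+2)+(\Psi-1)^2,$$ and let $$\delta_1=\frac{\Psi^2(\Phi-1)}{\Phi^2(\Phi+\Psi-1)},\qquad \delta_2=\frac{\Psi}{\Phi+\Psi-1},\qquad \delta_3=\frac{\Phi-1}{\Phi+\Psi-1},$$ $$C(x,y;\Phi)=\delta_1(x-\Phi)-\delta_2(y-\Psi)+c_2(\Phi)\left[\delta_1(x-\Phi)+\delta_3(y-\Psi)\right]^2+c_3(\Phi)\left[\delta_1(x-\Phi)+\delta_3(y-\Psi)\right]^3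 .$$ Let $C(x,y;\Psi)$ be the expression obtained from $C(x,y;\Phi)$ by interchanging $\Phi$ and $\Psi$ everywhere (including in $c_2,c_3,\kappa_i,\delta_i$). Then, corresponding to the non-hyperbolic period-two solution $\{(\Phi,\Psi),(\Psi,\Phi)\}$, there is an invariant curve which is the union of two curves that are locally given by the asymptotic expansions $C(x,\tilde h(x);\Phi)=0$ and $C(x,\tilde h(x);\Psi)=0$. That is, let $\tilde h_\Phi$ be the smooth function near $\Phi$ with $\tilde h_\Phi(\Phi)=\Psi$ and $C(x,\tilde h_\Phi(x);\Phi)=0$, and let $\tilde h_\Psi$ be the smooth function near $\Psi$ with $\tilde h_\Psi(\Psi)=\Phi$ and $C(x,\tilde h_\Psi(x);\Psi)=0$. Then there exists a set $\mathcal C=\mathcal C_1\cup\mathcal C_2$, invariant under $T^2$, such that near $(\Phi,\Psi)$ the curve $\mathcal C_1$ is the graph $\{(x,h_1(x))\}$ of a smooth function $h_1$ defined near $\Phi$ with $h_1(x)=\tilde h_\Phi(x)+O(|x-\Phi|^4)$ as $x\to\Phi$, and near $(\Psi,\Phi)$ the curve $\mathcal C_2$ is the graph $\{(x,h_2(x))\}$ of a smooth function $h_2$ defined near $\Psi$ with $h_2(x)=\tilde h_\Psi(x)+O(|x-\Psi|^4)$ as $x\to\Psi$.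
   Context: In the plane, a point $(x,y)$ corresponds to $(x_{n-1},x_n)$. For $\alpha=1$, the map $T^2=T\circ T$ has fixed points $(\Phi,\Psi)$ and $(\Psi,\Phi)$, where $\frac1\Phi+\frac1\Psi=1-\beta$ (so also $\Psi>\frac1{1-\beta}$); initial conditions $x_{-1}=\Phi$, $x_0=\Psi$ give the 2-periodic solution $\Phi,\Psi,\Phi,\Psi,\ldots$. The Jacobian of $T^2$ at $(\Phi,\Psi)$ has eigenvalues $\left(1-\frac1\Phi\right)\left(1-\frac1\Psi\right)\in(0,1)$ and $1$, hence the period-two solution is non-hyperbolic. A set $\mathcal C$ is called invariant under $T^2$ if $T^2(\mathcal C)\subseteq\mathcal C$. *)

(* Defs.v *)
From Stdlib Require Import Reals.
From Coquelicot Require Import Coquelicot.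
Open Scope R_scope.

(* Associated map of x_{n+1} = 1 + beta x_{n-1} + x_{n-1} / x_n, where
   p = (x_{n-1}, x_n).  It is total on R * R, but meaningful only on
   [pos_quadrant]. *)
Definition T (beta : R) (p : R * R) : R * R :=
  (snd p, 1 + beta * fst p + fst p / snd p).

Definition T2 (beta : R) (p : R * R) : R * R := T beta (T beta p).

Definition pos_quadrant (p : R * R) : Prop := 0 < fst p /\ 0 < snd p.

Definition invariant (F : R * R -> R * R) (S : R * R -> Prop) : Prop :=
  forall p, S p -> S (F p).

Definition union (A B : R * R -> Prop) (p : R * R) : Prop := A p \/ B p.

Definition kappa1 (Phi Psi : R) : R := 3 * Psi ^ 2 - 4 * Psi + 1.
Definition kappa2 (Phi Psi : R) : R :=
  3 * Psi ^ 3 - 12 * Psi ^ 2 + 9 * Psi - 1.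
Definition kappa3 (Phi Psi : R) : R :=
  5 * Psi ^ 3 - 14 * Psi ^ 2 + 6 * Psi + 1.
Definition kappa4 (Phi Psi : R) : R :=
  2 * Psi ^ 3 - 4 * Psi ^ 2 + Psi + 1.
Definition kappa5 (Phi Psi : R) : R :=
  Phi ^ 2 * (3 * Psi ^ 2 - 3 * Psi + 1) - Phi * (3 * Psi ^ 2 - 5 * Psi + 2)
  + (Psi - 1) ^ 2.

Definition c2 (Phi Psi : R) : R :=
  Phi / ((1 - Phi) * (Phi + Psi - 1) * (2 * Phi * Psi - Phi - Psi + 1)).

Definition c3 (Phi Psi : R) : R :=
  (Phi ^ 4 * kappa1 Phi Psi + Phi ^ 3 * kappa2 Phi Psi
   - Phi ^ 2 * kappa3 Phi Psi + Phi * kappa4 Phi Psi)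
  / (Psi * (Psi + Phi - 1) * (1 - Phi) * kappa5 Phi Psi) * c2 Phi Psi.

Definition delta1 (Phi Psi : R) : R :=
  (Psi ^ 2 * (Phi - 1)) / (Phi ^ 2 * (Phi + Psi - 1)).
Definition delta2 (Phi Psi : R) : R := Psi / (Phi + Psi - 1).
Definition delta3 (Phi Psi : R) : R := (Phi - 1) / (Phi + Psi - 1).

(* [Cexp Phi Psi x y] is C(x, y; Phi); interchanging Phi and Psi everywhere
   gives C(x, y; Psi) = [Cexp Psi Phi x y]. *)
Definition Cexp (Phi Psi x y : R) : R :=
  delta1 Phi Psi * (x - Phi) - delta2 Phi Psi * (y - Psi)
  + c2 Phi Psi * (delta1 Phi Psi * (x - Phi) + delta3 Phi Psi * (y - Psi)) ^ 2
  + c3 Phi Psi * (delta1 Phi Psi * (x - Phi) + delta3 Phi Psi * (y - Psi)) ^ 3.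

(* C^infinity on a neighbourhood of a; the values of h elsewhere are
   irrelevant, so a total h represents a function defined only near a. *)
Definition smooth_near (h : R -> R) (a : R) : Prop :=
  locally a (fun x => forall n : nat, ex_derive_n h n x).

(* The implicit function theorem applies at (Phi, Psi), since the partial
   derivative of [Cexp Phi Psi] in y there is - delta2 Phi Psi <> 0; hence such
   an h exists and its germ at Phi is unique. *)
Definition implicit_branch (Phi Psi : R) (h : R -> R) : Prop :=
  smooth_near h Phi /\ h Phi = Psi
  /\ locally Phi (fun x => Cexp Phi Psi x (h x) = 0).

Definition is_interval (I : R -> Prop) : Prop :=
  forall x y z, I x -> I y -> x <= z <= y -> I z.

(* A curve is a continuous one-to-one image of a nondegenerate interval;
   injectivity excludes space-filling images. *)
Definition is_curve (S : R * R -> Prop) : Prop :=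
  exists (I : R -> Prop) (g : R -> R * R),
    is_interval I
    /\ (exists s t, I s /\ I t /\ s < t)
    /\ continuous_on I g
    /\ (forall s t, I s -> I t -> g s = g t -> s = t)
    /\ (forall p, S p <-> exists t, I t /\ p = g t).

Definition graph_near (S : R * R -> Prop) (p0 : R * R) (h : R -> R) : Prop :=
  locally p0 (fun p => S p <-> snd p = h (fst p)).

(* f(x) = g(x) + O(|x - a|^k) as x -> a; x = a is included. *)
Definition eq_upto_O (f g : R -> R) (a : R) (k : nat) : Prop :=
  exists M : R, locally a (fun x => Rabs (f x - g x) <= M * Rabs (x - a) ^ k).

(* Main.v *)
(** The curve is the strong stable manifold of the non-hyperbolic fixed point
    [(P, Q)] of [T2], tangent to the eigenvector of the eigenvalue
    [lam = (1 - 1/P) (1 - 1/Q)].  It is sought in parametrized form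
    [t |-> (a t, b t)] with [T2 (a t, b t) = (a (lam t), b (lam t))], i.e.
      [a (lam t) = 1 + beta a t + a t / b t],
      [b (lam t) = 1 + beta b t + b t / a (lam t)].
    After clearing denominators both equations are quadratic, and the n-th
    Taylor coefficients solve a 2x2 linear system of determinant
    [P Q (1 - lam^n) (lam - lam^n)], bounded away from 0 for [n >= 2], whose
    right-hand side is a Cauchy product of earlier coefficients.  Rescaling [t]
    makes the first coefficient small, and then all coefficients are at most
    [A / n^2], so the series converge on the unit disc.  The invariant curve is
    the graph of [b o a^-1].  The coefficients up to order 3 show that
    [Cexp P Q (a t) (b t) = O(t^4)], and as [Cexp] has nonzero derivative in [y]
    this transfers to the implicit branch.  The second curve is obtained by
    exchanging [P] and [Q]. *)

Require Import Defs.
From Stdlib Require Import Reals.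
From Coquelicot Require Import Coquelicot.
From Stdlib Require Import Lra Lia Psatz Ranalysis5 ClassicalEpsilon.
Open Scope R_scope.

(** * Functions of class C^n *)

(** The derivative is an existential witness, so closure properties go by induction on [n] without
    formulas for iterated derivatives. Order [n] means [n]-fold differentiability on [U]. *)
Fixpoint Cn (U : R -> Prop) (n : nat) (f : R -> R) : Prop :=
  match n with
  | O => True
  | S n => exists f', (forall x, U x -> is_derive f x (f' x)) /\ Cn U n f'
  end.

Lemma Cn_pred U n f : Cn U (S n) f -> Cn U n f.
Proof.
revert f; induction n as [|n IH]; intros f [f' [D C]]; [exact I|].
exists f'; split; [exact D|]; apply IH, C.
Qed.

Lemma Cn_const U n c : Cn U n (fun _ => c).
Proof.
revert c; induction n as [|n IH]; intros c; [exact I|].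
exists (fun _ => 0); split; [|apply IH].
intros x _; apply @is_derive_const.
Qed.

Lemma Cn_id U n : Cn U n (fun x => x).
Proof.
destruct n as [|n]; [exact I|].
exists (fun _ => 1); split; [|apply Cn_const].
intros x _; apply @is_derive_id.
Qed.

Lemma Cn_plus U n f g : Cn U n f -> Cn U n g -> Cn U n (fun x => f x + g x).
Proof.
revert f g; induction n as [|n IH]; intros f g; [easy|].
intros [f' [Df Cf]] [g' [Dg Cg]].
exists (fun x => f' x + g' x); split; [|now apply IH].
intros x Ux; apply @is_derive_plus; auto.
Qed.

Lemma Cn_mult U n f g : Cn U n f -> Cn U n g -> Cn U n (fun x => f x * g x).
Proof.
revert f g; induction n as [|n IH]; intros f g; [easy|].
intros Hf Hg; generalize (Cn_pred _ _ _ Hf) (Cn_pred _ _ _ Hg).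
destruct Hf as [f' [Df Cf]], Hg as [g' [Dg Cg]]; intros Hf Hg.
exists (fun x => f' x * g x + f x * g' x); split.
- intros x Ux; apply (is_derive_mult f g); auto; apply Rmult_comm.
- apply Cn_plus; now apply IH.
Qed.

Lemma Cn_inv U n f :
  (forall x, U x -> f x <> 0) -> Cn U n f -> Cn U n (fun x => / f x).
Proof.
intros Hne; induction n as [|n IH]; [easy|].
intros Hf; generalize (IH (Cn_pred _ _ _ Hf)); intros Hi.
destruct Hf as [f' [Df Cf]].
(* The derivative is written through [/ f] itself, to which the induction hypothesis applies. *)
exists (fun x => - 1 * f' x * (/ f x * / f x)); split.
- intros x Ux.
  replace (-1 * f' x * (/ f x * / f x)) with (- f' x / f x ^ 2)
    by (field; auto).
  apply is_derive_inv; auto.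
- repeat apply Cn_mult; auto; apply Cn_const.
Qed.

Lemma Cn_PSeries (a : nat -> R) (U : R -> Prop) n :
  (forall x, U x -> Rbar_lt (Rabs x) (CV_radius a)) -> Cn U n (PSeries a).
Proof.
revert a; induction n as [|n IH]; intros a Ha; [exact I|].
exists (PSeries (PS_derive a)); split.
- intros x Ux; apply is_derive_PSeries; auto.
- apply IH; intros x Ux; rewrite CV_radius_derive; auto.
Qed.

Lemma Cn_ex_derive_n U n f x : open U -> Cn U n f -> U x -> ex_derive_n f n x.
Proof.
intros HU Hf Ux; destruct n as [|n]; [exact I|]; simpl.
revert f x Hf Ux; induction n as [|n IH]; intros f x [f' [Df Cf]] Ux.
- exists (f' x); now apply Df.
- apply ex_derive_ext_loc with (Derive_n f' n); [|now apply IH].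
  apply (filter_imp U); [|now apply HU].
  intros y Uy.
  replace (S n) with (n + 1)%nat by lia.
  rewrite <- Derive_n_comp; apply Derive_n_ext_loc.
  apply (filter_imp U); [|now apply HU].
  intros z Uz; symmetry; apply is_derive_unique; auto.
Qed.

Lemma Cn_subset (U V : R -> Prop) n f :
  (forall x, V x -> U x) -> Cn U n f -> Cn V n f.
Proof.
intros H; revert f; induction n as [|n IH]; intros f; [easy|].
intros [f' [D C]]; exists f'; split; [auto|now apply IH].
Qed.

Lemma Cn_ext U n f g :
  open U -> (forall x, U x -> f x = g x) -> Cn U n f -> Cn U n g.
Proof.
intros HU E; destruct n as [|n]; [easy|].
intros [f' [D C]]; exists f'; split; [|exact C].
intros x Ux; apply is_derive_ext_loc with f; [|auto].
apply (filter_imp U); [exact E|now apply HU].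
Qed.

(** The witnesses may vary with [n], but on an open set they all equal [Derive f], which therefore
    serves every order at once. *)
Lemma Cn_Derive U f : open U -> (forall n, Cn U n f) ->
  (forall x, U x -> is_derive f x (Derive f x)) /\ forall n, Cn U n (Derive f).
Proof.
intros HU C; split.
- intros x Ux; destruct (C 1%nat) as [f' [D _]].
  apply Derive_correct; exists (f' x); now apply D.
- intros n; destruct (C (S n)) as [f' [D C']].
  apply Cn_ext with f'; auto.
  intros x Ux; symmetry; apply is_derive_unique; auto.
Qed.

Lemma open_Rabs_lt (a r : R) : open (fun x => Rabs (x - a) < r).
Proof.
intros x Hx; exists (mkposreal (r - Rabs (x - a)) ltac:(lra)); simpl.
intros y Hy; change (Rabs (y - x) < r - Rabs (x - a)) in Hy.
replace (y - a) with ((y - x) + (x - a)) by ring.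
apply Rle_lt_trans with (1 := Rabs_triang _ _); lra.
Qed.

(** * Smooth inverses *)

Lemma is_derive_expanding (f f' : R -> R) (r m : R) :
  (forall t, Rabs t < r -> is_derive f t (f' t)) ->
  (forall t, Rabs t < r -> m <= f' t) ->
  forall s t, Rabs s < r -> Rabs t < r -> s <= t -> m * (t - s) <= f t - f s.
Proof.
intros D B s t Hs Ht Hst.
apply Rabs_lt_between in Hs; apply Rabs_lt_between in Ht.
assert (I : forall x, s <= x <= t -> Rabs x < r)
  by (intros x Hx; apply Rabs_lt_between; lra).
destruct (MVT_gen f s t f') as [c [Hc E]];
  rewrite ?Rmin_left, ?Rmax_right in * by lra.
- intros x Hx; apply D, I; lra.
- intros x Hx; apply continuity_pt_filterlim, @ex_derive_continuous.
  exists (f' x); apply D, I; lra.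
- rewrite E; apply Rmult_le_compat_r; [lra|]; apply B, I; lra.
Qed.

(** A derivative of at least [m] makes [f] expanding, hence injective with an inverse of Lipschitz
    constant [1 / m]; the intermediate value theorem gives surjectivity onto a ball. *)
Lemma local_inverse (f f' : R -> R) (r m : R) :
  0 < r -> 0 < m ->
  (forall t, Rabs t < r -> is_derive f t (f' t)) ->
  (forall t, Rabs t < r -> m <= f' t) ->
  exists g : R -> R, exists rho : R, 0 < rho
  /\ (forall x, Rabs (x - f 0) < rho -> Rabs (g x) < r /\ f (g x) = x)
  /\ (forall t, Rabs t < r -> Rabs (f t - f 0) < rho -> g (f t) = t)
  /\ (forall x, Rabs (x - f 0) < rho -> m * Rabs (g x) <= Rabs (x - f 0))
  /\ (forall x, Rabs (x - f 0) < rho -> is_derive g x (/ f' (g x))).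
Proof.
intros Hr Hm D B.
assert (E := is_derive_expanding f f' r m D B).
assert (E' : forall s t, Rabs s < r -> Rabs t < r ->
             m * Rabs (t - s) <= Rabs (f t - f s)).
{ intros s t Hs Ht; destruct (Rle_or_lt s t) as [Hst|Hst].
  - rewrite (Rabs_pos_eq (t - s)) by lra.
    apply Rle_trans with (2 := Rle_abs _); auto.
  - rewrite (Rabs_minus_sym t), (Rabs_minus_sym (f t)).
    rewrite (Rabs_pos_eq (s - t)) by lra.
    apply Rle_trans with (2 := Rle_abs _); apply E; auto; lra. }
assert (H0 : Rabs 0 < r) by (rewrite Rabs_R0; lra).
(* [f] moves [r / 2] and [- (r / 2)] at least this far from [f 0], to opposite sides. *)
pose (rho := m * (r / 2)).
assert (Hrho : 0 < rho) by (unfold rho; nra).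
(* The premise stands under the existential so that choice yields a total [g]; outside the ball its
   values are arbitrary. *)
assert (S : forall x, exists t, Rabs (x - f 0) < rho -> Rabs t < r /\ f t = x).
{ intros x; destruct (Rlt_or_le (Rabs (x - f 0)) rho) as [Hx|Hx];
    [|exists 0; lra].
  apply Rabs_lt_between in Hx.
  assert (H1 : Rabs (r / 2) < r) by (rewrite Rabs_pos_eq; lra).
  assert (H2 : Rabs (- (r / 2)) < r) by (rewrite Rabs_Ropp, Rabs_pos_eq; lra).
  assert (H3 := E 0 (r / 2) H0 H1 ltac:(lra)).
  assert (H4 := E _ 0 H2 H0 ltac:(lra)).
  replace (r / 2 - 0) with (r / 2) in H3 by ring.
  replace (0 - - (r / 2)) with (r / 2) in H4 by ring.
  fold rho in H3, H4.
  destruct (IVT_interv (fun t => f t - x) (- (r / 2)) (r / 2)) as [z [Hz Ez]];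
    try lra.
  - intros a Ha; apply continuity_pt_filterlim.
    apply (ex_derive_continuous (fun t => f t - x)).
    apply (ex_derive_minus f (fun _ => x)); [|apply ex_derive_const].
    exists (f' a); apply D, Rabs_lt_between; lra.
  - exists z; intros _; split; [apply Rabs_lt_between|]; lra. }
pose (g := fun x => proj1_sig (constructive_indefinite_description _ (S x))).
assert (G : forall x, Rabs (x - f 0) < rho -> Rabs (g x) < r /\ f (g x) = x).
{ intros x; unfold g; now destruct constructive_indefinite_description. }
exists g, rho; split; [exact Hrho|]; split; [exact G|]; split; [|split].
- intros t Ht Hft; destruct (G _ Hft) as [G1 G2].
  assert (H := E' t (g (f t)) Ht G1).
  rewrite G2, Rminus_diag, Rabs_R0 in H.
  assert (K := Rabs_pos (g (f t) - t)).
  destruct (Req_dec (g (f t) - t) 0) as [Z|Z]; [lra|].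
  apply Rabs_pos_lt in Z; nra.
- intros x Hx; destruct (G x Hx) as [G1 G2].
  assert (H := E' 0 (g x) H0 G1); rewrite G2 in H.
  now rewrite Rminus_0_r in H.
- intros x Hx; destruct (G x Hx) as [G1 G2].
  assert (Bx := B _ G1); assert (Dx := D _ G1).
  apply is_derive_Reals in Dx; apply is_derive_Reals.
  set (d := f' (g x)) in *; intros eps Heps.
  (* With [k] the increment of [g], the error [|k/h - 1/d|] is [|h/k - d|] times [|k/h|] times
     [1/d], and the last two factors are at most [1/m]. *)
  destruct (Dx (eps * (m * m))) as [[del Hdel] Hd].
  { apply Rmult_lt_0_compat; nra. }
  simpl in Hd.
  assert (Hd' : 0 < Rmin (m * del) (rho - Rabs (x - f 0))).
  { apply Rmin_glb_lt; nra. }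
  exists (mkposreal _ Hd'); simpl; intros h Hh Hlt.
  assert (L1 := Rlt_le_trans _ _ _ Hlt (Rmin_l _ _)).
  assert (L2 := Rlt_le_trans _ _ _ Hlt (Rmin_r _ _)).
  assert (Hxh : Rabs (x + h - f 0) < rho).
  { replace (x + h - f 0) with ((x - f 0) + h) by ring.
    apply Rle_lt_trans with (1 := Rabs_triang _ _); lra. }
  destruct (G _ Hxh) as [F1 F2].
  set (k := g (x + h) - g x).
  assert (Ek : f (g x + k) - f (g x) = h).
  { unfold k; replace (g x + (g (x + h) - g x)) with (g (x + h)) by ring.
    rewrite F2, G2; ring. }
  assert (Kk : m * Rabs k <= Rabs h).
  { assert (H := E' _ _ G1 F1); rewrite F2, G2 in H.
    now replace (x + h - x) with h in H by ring. }
  assert (Nk : k <> 0).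
  { intros Z; apply Hh; rewrite <- Ek, Z, Rplus_0_r; ring. }
  assert (Q : Rabs (h / k - d) < eps * (m * m)).
  { assert (H : Rabs k < del) by nra.
    specialize (Hd k Nk H); now rewrite Ek in Hd. }
  replace (k / h - / d) with ((h / k - d) * (- (k / h) * / d))
    by (field; repeat split; lra).
  assert (P1 : Rabs (- (k / h) * / d) <= / (m * m)).
  { rewrite Rabs_mult, Rabs_Ropp, Rinv_mult.
    apply Rmult_le_compat; try apply Rabs_pos.
    - unfold Rdiv; rewrite Rabs_mult, Rabs_inv.
      apply Rabs_pos_lt in Hh.
      apply Rmult_le_reg_r with (Rabs h); [lra|].
      apply Rmult_le_reg_l with m; [lra|].
      replace (m * (/ m * Rabs h)) with (Rabs h) by (field; lra).
      replace (m * (Rabs k * / Rabs h * Rabs h)) with (m * Rabs k)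
        by (field; lra); lra.
    - rewrite Rabs_inv, Rabs_pos_eq by lra; apply Rinv_le_contravar; lra. }
  rewrite Rabs_mult.
  apply Rle_lt_trans with (Rabs (h / k - d) * / (m * m)).
  { apply Rmult_le_compat_l; [apply Rabs_pos|exact P1]. }
  apply Rmult_lt_reg_r with (m * m); [nra|].
  rewrite Rmult_assoc, Rinv_l by nra; lra.
Qed.

(** The derivative of [phi (g x)] is [phi' / f'] evaluated at [g x], again an outer function
    composed with [g]; so the induction runs over [phi]. *)
Lemma Cn_comp_inverse (U V : R -> Prop) (f' g phi : R -> R) n :
  (forall x, V x -> U (g x)) ->
  (forall t, U t -> f' t <> 0) ->
  (forall x, V x -> is_derive g x (/ f' (g x))) ->
  (forall n, Cn U n f') ->
  Cn U n phi -> Cn V n (fun x => phi (g x)).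
Proof.
intros VU Hne Dg Cf'; revert phi.
induction n as [|n IH]; intros phi; [easy|].
intros [phi' [D C]].
exists (fun x => phi' (g x) * / f' (g x)); split.
- intros x Vx; rewrite Rmult_comm; apply (is_derive_comp phi g); auto.
- apply (IH (fun t => phi' t * / f' t)).
  apply Cn_mult; [exact C|]; apply Cn_inv; auto.
Qed.

(** * Power series of the invariant curve *)

Lemma sum_f_R0_rev (f : nat -> R) n :
  sum_f_R0 (fun j => f (n - j)%nat) n = sum_f_R0 f n.
Proof.
revert f; induction n as [|n IH]; intros f; [reflexivity|].
rewrite tech5, (decomp_sum f (S n)) by lia; simpl (pred (S n)).
rewrite Nat.sub_diag, <- (IH (fun j => f (S j))), Rplus_comm.
f_equal; apply sum_eq; intros j Hj; f_equal; lia.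
Qed.

Lemma sum_inv_sqr_le n : sum_f_R0 (fun j => / INR (S j) ^ 2) n <= 2.
Proof.
(* The sharper bound is inductive, because [1/(x+1)^2 <= 1/x - 1/(x+1)]. *)
cut (sum_f_R0 (fun j => / INR (S j) ^ 2) n <= 2 - / INR (S n)).
{ assert (0 < / INR (S n)) by (apply Rinv_0_lt_compat, lt_0_INR; lia); lra. }
induction n as [|n IH]; [simpl; lra|].
rewrite tech5; assert (0 < INR (S n)) by (apply lt_0_INR; lia).
apply Rle_trans with (1 := Rplus_le_compat_r _ _ _ IH).
rewrite (S_INR (S n)); set (x := INR (S n)) in *.
apply Rminus_le_0.
replace (2 - / (x + 1) - (2 - / x + / (x + 1) ^ 2)) with (/ (x * (x + 1) ^ 2))
  by (field; lra).
apply Rlt_le, Rinv_0_lt_compat; nra.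
Qed.

(* [1/(xy)^2 <= 2 (1/x^2 + 1/y^2) / (x+y)^2] makes the weights [1/(j+1)^2]
   submultiplicative, up to a constant, for the Cauchy product. *)
Lemma conv_inv_sqr_le m :
  sum_f_R0 (fun j => / INR (S j) ^ 2 * / INR (S (m - j)) ^ 2) m
  <= 8 / INR (S (S m)) ^ 2.
Proof.
assert (N : 0 < INR (S (S m))) by (apply lt_0_INR; lia).
apply Rle_trans with (sum_f_R0 (fun j =>
  (/ INR (S j) ^ 2 + / INR (S (m - j)) ^ 2) * (2 / INR (S (S m)) ^ 2)) m).
- apply sum_Rle; intros j Hj.
  replace (INR (S (S m))) with (INR (S j) + INR (S (m - j)))
    by (rewrite <- plus_INR; f_equal; lia).
  assert (0 < INR (S j)) by (apply lt_0_INR; lia).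
  assert (0 < INR (S (m - j))) by (apply lt_0_INR; lia).
  set (x := INR (S j)) in *; set (y := INR (S (m - j))) in *.
  apply Rminus_le_0.
  replace (_ - _) with ((x - y) ^ 2 / (x * y * (x + y)) ^ 2)
    by (field; lra).
  apply Rmult_le_pos; [apply pow2_ge_0|].
  apply Rlt_le, Rinv_0_lt_compat, pow_lt.
  repeat apply Rmult_lt_0_compat; lra.
- rewrite <- scal_sum, plus_sum.
  rewrite (sum_f_R0_rev (fun j => / INR (S j) ^ 2)).
  assert (S2 := sum_inv_sqr_le m).
  replace (8 / INR (S (S m)) ^ 2) with (2 / INR (S (S m)) ^ 2 * (2 + 2))
    by (field; lra).
  apply Rmult_le_compat_l; [|lra].
  apply Rlt_le, Rdiv_lt_0_compat; [lra|]; apply pow_lt, N.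
Qed.

(** The product of index [m] receives the weight [1/(m+2)^2], which is the weight of the coefficient
    of index [m+1] that it will determine; hence the bound can reproduce itself along the
    recursion. *)
Lemma PS_mult_inv_sqr_le (u v : nat -> R) A B m :
  (forall j, (j <= m)%nat -> Rabs (u j) <= A / INR (S j) ^ 2) ->
  (forall j, (j <= m)%nat -> Rabs (v j) <= B / INR (S j) ^ 2) ->
  Rabs (PS_mult u v m) <= 8 * A * B / INR (S (S m)) ^ 2.
Proof.
intros Hu Hv; unfold PS_mult.
apply Rle_trans with (1 := Rsum_abs _ _).
assert (HA : 0 <= A).
{ assert (H := Rle_trans _ _ _ (Rabs_pos _) (Hu 0%nat ltac:(lia))).
  simpl in H; lra. }
assert (HB : 0 <= B).
{ assert (H := Rle_trans _ _ _ (Rabs_pos _) (Hv 0%nat ltac:(lia))).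
  simpl in H; lra. }
apply Rle_trans with (sum_f_R0
  (fun j => / INR (S j) ^ 2 * / INR (S (m - j)) ^ 2 * (A * B)) m).
- apply sum_Rle; intros j Hj; rewrite Rabs_mult.
  replace (_ * (A * B)) with ((A / INR (S j) ^ 2) * (B / INR (S (m - j)) ^ 2))
    by (unfold Rdiv; ring).
  apply Rmult_le_compat; try apply Rabs_pos; [apply Hu|apply Hv]; lia.
- rewrite <- scal_sum.
  replace (8 * A * B / _) with (A * B * (8 / INR (S (S m)) ^ 2))
    by (unfold Rdiv; ring).
  apply Rmult_le_compat_l; [nra|]; apply conv_inv_sqr_le.
Qed.

(** Course-of-values recursion through tables [F n] that are correct up to index [n]; by hypothesis
    [step m] does not see the entries beyond [m]. *)
Lemma strong_recursion (X : Type) (x0 : X) (step : nat -> (nat -> X) -> X) :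
  (forall m u v, (forall k, (k <= m)%nat -> u k = v k) ->
     step m u = step m v) ->
  exists u, u 0%nat = x0 /\ forall m, u (S m) = step m u.
Proof.
intros Hs.
pose (F := fix F n := match n with
  | O => fun _ => x0
  | S m => fun k => if Nat.leb k m then F m k else step m (F m) end).
assert (E : forall n k, (k <= n)%nat -> F n k = F k k).
{ intros n; induction n as [|n IH]; intros k Hk.
  - now replace k with 0%nat by lia.
  - destruct (Nat.eq_dec k (S n)) as [->|Hne]; [reflexivity|].
    simpl; rewrite (proj2 (Nat.leb_le k n)) by lia; apply IH; lia. }
exists (fun n => F n n); split; [reflexivity|].
intros m.
change ((if Nat.leb (S m) m then F m (S m) else step m (F m))
        = step m (fun n => F n n)).
rewrite (proj2 (Nat.leb_gt (S m) m)) by lia.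
apply Hs; intros k Hk; now apply E.
Qed.

Lemma PS_mult_ext_le (u v u' v' : nat -> R) m :
  (forall j, (j <= m)%nat -> u j = u' j) ->
  (forall j, (j <= m)%nat -> v j = v' j) ->
  PS_mult u v m = PS_mult u' v' m.
Proof.
intros Hu Hv; apply sum_eq; intros j Hj; rewrite Hu, Hv by lia; reflexivity.
Qed.

Lemma multiplier_bounds (P Q : R) :
  1 < P -> 1 < Q -> 0 < (1 - / P) * (1 - / Q) < 1.
Proof.
intros HP HQ.
assert (0 < / P) by (apply Rinv_0_lt_compat; lra).
assert (0 < / Q) by (apply Rinv_0_lt_compat; lra).
assert (/ P < 1) by (rewrite <- Rinv_1; apply Rinv_lt_contravar; lra).
assert (/ Q < 1) by (rewrite <- Rinv_1; apply Rinv_lt_contravar; lra).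
nra.
Qed.

Lemma cramer_bound a b c d x y D K B :
  0 < D -> 0 <= K -> 0 <= B -> a * d - b * c >= D ->
  Rabs a <= K -> Rabs b <= K -> Rabs c <= K -> Rabs d <= K ->
  Rabs x <= B -> Rabs y <= B ->
  Rabs ((d * x - b * y) / (a * d - b * c)) <= 2 * K * B / D
  /\ Rabs ((a * y - c * x) / (a * d - b * c)) <= 2 * K * B / D.
Proof.
intros HD HK HB Hdet Ha Hb Hc Hd Hx Hy.
assert (X : forall p q, Rabs p <= K -> Rabs q <= K -> forall z w,
  Rabs z <= B -> Rabs w <= B ->
  Rabs ((p * z - q * w) / (a * d - b * c)) <= 2 * K * B / D).
{ intros p q Hp Hq z w Hz Hw; unfold Rdiv.
  rewrite Rabs_mult, Rabs_inv, (Rabs_pos_eq (a * d - b * c)) by lra.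
  apply Rmult_le_compat; try apply Rabs_pos.
  - apply Rlt_le, Rinv_0_lt_compat; lra.
  - unfold Rminus; apply Rle_trans with (1 := Rabs_triang _ _).
    rewrite Rabs_Ropp, !Rabs_mult.
    assert (Rabs p * Rabs z <= K * B)
      by (apply Rmult_le_compat; auto using Rabs_pos).
    assert (Rabs q * Rabs w <= K * B)
      by (apply Rmult_le_compat; auto using Rabs_pos).
    lra.
  - apply Rinv_le_contravar; lra. }
split; apply X; auto.
Qed.

(* Indices are shifted by one: [al n] and [bt n] are the coefficients of
   [t^(n+1)] in [a t - P] and [b t - Q]. *)
Lemma manifold_coefficients (beta P Q : R) (lam := (1 - / P) * (1 - / Q)) :
  0 <= beta -> 1 < P -> 1 < Q -> / P + / Q = 1 - beta ->
  exists (al bt : nat -> R) (s : R), 0 < s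
  /\ al 0%nat = s * (P / Q) /\ bt 0%nat = s * (1 - / P)
  /\ (forall n, Rabs (al n) <= 1) /\ (forall n, Rabs (bt n) <= 1)
  /\ (forall m,
      ((lam ^ S (S m) - beta) * Q - 1) * al (S m) + P / Q * bt (S m)
      = - PS_mult (fun j => (lam ^ S j - beta) * al j) bt m)
  /\ (forall m,
      Q / P * lam ^ S (S m) * al (S m)
      + ((lam ^ S (S m) - beta) * P - 1) * bt (S m)
      = - PS_mult (fun j => (lam ^ S j - beta) * bt j)
                  (fun j => lam ^ S j * al j) m).
Proof.
intros Hb HP HQ Hbeta.
assert (Hlam : 0 < lam < 1) by now apply multiplier_bounds.
assert (iP : 0 < / P) by (apply Rinv_0_lt_compat; lra).
assert (iQ : 0 < / Q) by (apply Rinv_0_lt_compat; lra).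
assert (iP1 : / P < 1) by (rewrite <- Rinv_1; apply Rinv_lt_contravar; lra).
assert (iQ1 : / Q < 1) by (rewrite <- Rinv_1; apply Rinv_lt_contravar; lra).
assert (Hpow : forall n, 0 < lam ^ n <= 1).
{ intros n; split; [now apply pow_lt|].
  rewrite <- (pow1 n); apply pow_incr; lra. }
(* Matrix of the linear system of order [n] as a function of [l = lam^n]. Its determinant vanishes
   exactly at [l = 1] and [l = lam], the eigenvalues of the linearized [T2]. *)
pose (c11 := fun l => (l - beta) * Q - 1).
pose (c12 := P / Q).
pose (c21 := fun l => Q / P * l).
pose (c22 := fun l => (l - beta) * P - 1).
(* The determinant at [l = lam^2], a lower bound for all orders from 2 on since
   [lam^n <= lam^2 < lam]. *)
pose (D := P * Q * ((1 - lam ^ 2) * (lam - lam ^ 2))).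
pose (K := P + Q + 1).
assert (Hdet : forall l, c11 l * c22 l - c12 * c21 l
               = P * Q * ((1 - l) * (lam - l))).
{ intros l; unfold c11, c12, c21, c22, lam.
  replace beta with (1 - / P - / Q) by lra; field; lra. }
assert (Hl2 : lam ^ 2 < lam) by (simpl; nra).
assert (HD : 0 < D).
{ unfold D; repeat apply Rmult_lt_0_compat; lra. }
assert (HDm : forall m, c11 (lam ^ S (S m)) * c22 (lam ^ S (S m))
                        - c12 * c21 (lam ^ S (S m)) >= D).
{ intros m; rewrite Hdet; unfold D.
  assert (lam ^ S (S m) <= lam ^ 2).
  { replace (lam ^ S (S m)) with (lam ^ 2 * lam ^ m) by (simpl; ring).
    assert (H := Hpow m); assert (H2 := Hpow 2%nat); nra. }
  apply Rle_ge, Rmult_le_compat_l; [nra|].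
  apply Rmult_le_compat; lra. }
assert (PQ : 0 < P / Q <= K).
{ unfold Rdiv, K; split; [apply Rmult_lt_0_compat; lra|nra]. }
assert (QP : 0 < Q / P <= K).
{ unfold Rdiv, K; split; [apply Rmult_lt_0_compat; lra|nra]. }
assert (HK : forall l, 0 < l <= 1 -> Rabs (c11 l) <= K /\ Rabs c12 <= K
             /\ Rabs (c21 l) <= K /\ Rabs (c22 l) <= K).
{ intros l Hl; unfold c11, c12, c21, c22; repeat split; apply Rabs_le;
    unfold K in *; nra. }
(* [16 K A <= D] closes the induction: the quadratic right-hand side has size [8 A^2], and solving
   the system costs a factor [2 K / D]. [A <= 1] gives the final bound 1. *)
pose (A := Rmin 1 (D / (16 * K))).
assert (K0 : 0 < K) by (unfold K; lra).
assert (HA : 0 < A).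
{ apply Rmin_glb_lt; [lra|]; apply Rdiv_lt_0_compat; lra. }
assert (HA1 : A <= 1) by apply Rmin_l.
assert (HA2 : 16 * K * A <= D).
{ apply Rle_trans with (16 * K * (D / (16 * K))).
  - apply Rmult_le_compat_l; [lra|]; apply Rmin_r.
  - right; field; lra. }
(* The eigenvector [(P/Q, 1 - 1/P)] of [lam] has entries at most [K], so after scaling by [s] they
   are at most [A]. *)
pose (s := A / K).
assert (Hs : 0 < s) by (apply Rdiv_lt_0_compat; lra).
pose (r1 := fun m (u : nat -> R * R) =>
  - PS_mult (fun j => (lam ^ S j - beta) * fst (u j)) (fun j => snd (u j)) m).
pose (r2 := fun m (u : nat -> R * R) =>
  - PS_mult (fun j => (lam ^ S j - beta) * snd (u j))
            (fun j => lam ^ S j * fst (u j)) m).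
(* Cramer's rule for the coefficients of index [S m]; they belong to [t^(m+2)], hence the power
   [lam ^ S (S m)]. *)
destruct (strong_recursion (R * R) (s * (P / Q), s * (1 - / P))
  (fun m u => let l := lam ^ S (S m) in
     let d := c11 l * c22 l - c12 * c21 l in
     ((c22 l * r1 m u - c12 * r2 m u) / d,
      (c11 l * r2 m u - c21 l * r1 m u) / d))) as [u [U0 US]].
{ intros m u v E; cbv zeta.
  assert (E1 : r1 m u = r1 m v).
  { unfold r1; f_equal; apply PS_mult_ext_le; intros j Hj; now rewrite E. }
  assert (E2 : r2 m u = r2 m v).
  { unfold r2; f_equal; apply PS_mult_ext_le; intros j Hj; now rewrite E. }
  now rewrite E1, E2. }
assert (HU : forall n k, (k <= n)%nat -> Rabs (fst (u k)) <= A / INR (S k) ^ 2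
                                  /\ Rabs (snd (u k)) <= A / INR (S k) ^ 2).
{ induction n as [|n IH]; intros k Hk.
  - replace k with 0%nat by lia; rewrite U0; simpl fst; simpl snd.
    replace (A / INR 1 ^ 2) with (s * K) by (unfold s; simpl; field; lra).
    rewrite !Rabs_mult, (Rabs_pos_eq s) by lra.
    split; apply Rmult_le_compat_l; try lra; apply Rabs_le; unfold K in *; lra.
  - destruct (Nat.eq_dec k (S n)) as [->|Hne]; [|apply IH; lia].
    rewrite US; cbv zeta; set (l := lam ^ S (S n)).
    assert (N : 0 < / INR (S (S n)) ^ 2).
    { apply Rinv_0_lt_compat, pow_lt, lt_0_INR; lia. }
    assert (Hw : forall j, Rabs (lam ^ S j - beta) <= 1).
    { intros j; assert (H := Hpow (S j)); apply Rabs_le; lra. }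
    assert (M : forall a b c, Rabs a <= 1 -> Rabs b <= c -> Rabs (a * b) <= c).
    { intros a b c Ha Hb'; rewrite Rabs_mult.
      assert (H := Rabs_pos a); assert (H' := Rabs_pos b); nra. }
    assert (R1 : Rabs (r1 n u) <= 8 * A * A / INR (S (S n)) ^ 2).
    { unfold r1; rewrite Rabs_Ropp; apply PS_mult_inv_sqr_le; intros j Hj;
        destruct (IH j Hj); [apply M|]; auto. }
    assert (R2 : Rabs (r2 n u) <= 8 * A * A / INR (S (S n)) ^ 2).
    { unfold r2; rewrite Rabs_Ropp; apply PS_mult_inv_sqr_le; intros j Hj;
        destruct (IH j Hj); apply M; auto.
      assert (H1 := Hpow (S j)); rewrite Rabs_pos_eq; lra. }
    destruct (HK l (Hpow _)) as [K1 [K2 [K3 K4]]].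
    assert (F : 2 * K * (8 * A * A / INR (S (S n)) ^ 2) / D
                <= A / INR (S (S n)) ^ 2).
    { replace (2 * K * (8 * A * A / INR (S (S n)) ^ 2) / D)
        with ((16 * K * A) * / D * (A * / INR (S (S n)) ^ 2))
        by (unfold Rdiv; ring).
      rewrite <- (Rmult_1_l (A / _)); apply Rmult_le_compat_r; [nra|].
      apply Rmult_le_reg_r with D; [lra|].
      rewrite Rmult_assoc, Rinv_l by lra; lra. }
    destruct (cramer_bound (c11 l) c12 (c21 l) (c22 l) (r1 n u) (r2 n u) D K
      (8 * A * A / INR (S (S n)) ^ 2)) as [G1 G2]; auto; try lra.
    { unfold Rdiv; apply Rmult_le_pos; nra. }
    { apply HDm. }
    split; simpl fst; simpl snd; lra. }
assert (HB : forall n, Rabs (fst (u n)) <= 1 /\ Rabs (snd (u n)) <= 1).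
{ intros n; destruct (HU n n (le_n n)) as [H1 H2].
  assert (A / INR (S n) ^ 2 <= 1).
  { assert (1 <= INR (S n)) by (rewrite S_INR; assert (H := pos_INR n); lra).
    assert (/ INR (S n) ^ 2 <= 1).
    { rewrite <- Rinv_1; apply Rinv_le_contravar; [lra|]; apply pow_R1_Rle; lra. }
    assert (0 < / INR (S n) ^ 2).
    { apply Rinv_0_lt_compat, pow_lt; lra. }
    unfold Rdiv; nra. }
  lra. }
exists (fun n => fst (u n)), (fun n => snd (u n)), s.
split; [exact Hs|]; rewrite U0; do 2 (split; [reflexivity|]).
split; [apply HB|]; split; [apply HB|]; split; intros m.
- fold (r1 m u); rewrite US; cbv zeta; cbn [fst snd].
  assert (H := HDm m); set (l := lam ^ S (S m)) in *.
  fold (c11 l) c12; field; lra.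
- fold (r2 m u); rewrite US; cbv zeta; cbn [fst snd].
  assert (H := HDm m); set (l := lam ^ S (S m)) in *.
  fold (c21 l) (c22 l); field; lra.
Qed.

(** * Contact with the cubic expansion *)

Lemma cramer_unique a b c d x y p q D : a * d - b * c = D -> D <> 0 ->
  a * x + b * y = p -> c * x + d * y = q ->
  x = (d * p - b * q) / D /\ y = (a * q - c * p) / D.
Proof. intros <- Hd <- <-; split; field; exact Hd. Qed.

Ltac positivity := repeat first
  [apply Rdiv_lt_0_compat | apply Rmult_lt_0_compat | apply pow_lt]; lra.

(** The pair [(xi, yi)] multiplies [t^(i+1)]. The four equations are the recursion at orders 2 and
    3, and the conclusions are the coefficients of [t], [t^2], [t^3] in [Cexp] along the curve.
    Solving and substituting verifies the formulas for [c2] and [c3]. *)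
Lemma contact_identities (P Q s x1 y1 x2 y2 : R)
  (lam := (1 - / P) * (1 - / Q)) (beta := 1 - / P - / Q)
  (x0 := s * (P / Q)) (y0 := s * (1 - / P)) :
  1 < P -> 1 < Q ->
  ((lam ^ 2 - beta) * Q - 1) * x1 + P / Q * y1 = - ((lam - beta) * x0 * y0) ->
  Q / P * lam ^ 2 * x1 + ((lam ^ 2 - beta) * P - 1) * y1
    = - ((lam - beta) * y0 * (lam * x0)) ->
  ((lam ^ 3 - beta) * Q - 1) * x2 + P / Q * y2
    = - ((lam - beta) * x0 * y1 + (lam ^ 2 - beta) * x1 * y0) ->
  Q / P * lam ^ 3 * x2 + ((lam ^ 3 - beta) * P - 1) * y2
    = - ((lam - beta) * y0 * (lam ^ 2 * x1)
         + (lam ^ 2 - beta) * y1 * (lam * x0)) ->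
  let d1 := delta1 P Q in let d2 := delta2 P Q in let d3 := delta3 P Q in
  d1 * x0 - d2 * y0 = 0
  /\ d1 * x1 - d2 * y1 + c2 P Q * (d1 * x0 + d3 * y0) ^ 2 = 0
  /\ d1 * x2 - d2 * y2
     + 2 * c2 P Q * (d1 * x0 + d3 * y0) * (d1 * x1 + d3 * y1)
     + c3 P Q * (d1 * x0 + d3 * y0) ^ 3 = 0.
Proof.
intros HP HQ E1 E2 E3 E4.
assert (N1 : 0 < P + Q - 1) by lra.
assert (N2 : 0 < 2 * P * Q - P - Q + 1) by nra.
(* Up to [(P Q)^2], [kappa5] is the factor [(1 - lam^3) / (1 - lam)] of the determinant of order 3;
   this form shows that it is positive. *)
assert (H5 : kappa5 P Q = (P * Q) ^ 2 * (1 + lam + lam ^ 2))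
  by (unfold kappa5, lam; field; lra).
assert (N0 : 0 < P * Q) by nra.
assert (N4 : 0 < (P - 1) * (Q - 1)) by nra.
assert (L : 0 < lam).
{ replace lam with ((P - 1) * (Q - 1) / (P * Q)) by (unfold lam; field; lra).
  now apply Rdiv_lt_0_compat. }
assert (N3 : 0 < kappa5 P Q).
{ rewrite H5; apply Rmult_lt_0_compat; [now apply pow_lt|nra]. }
assert (Dt : forall l, ((l - beta) * Q - 1) * ((l - beta) * P - 1)
            - P / Q * (Q / P * l) = P * Q * ((1 - l) * (lam - l))).
{ intros l; unfold lam, beta; field; lra. }
(* Both determinants are factored by means of [1 - lam = (P + Q - 1) / (P Q)] and
   [1 + lam = (2 P Q - P - Q + 1) / (P Q)], which makes their positivity visible. *)
assert (D2 : ((lam ^ 2 - beta) * Q - 1) * ((lam ^ 2 - beta) * P - 1)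
    - P / Q * (Q / P * lam ^ 2)
  = ((P + Q - 1) / (P * Q)) ^ 2 * (2 * P * Q - P - Q + 1)
    * ((P - 1) * (Q - 1) / (P * Q))).
{ rewrite Dt; unfold lam; field; lra. }
assert (D3 : ((lam ^ 3 - beta) * Q - 1) * ((lam ^ 3 - beta) * P - 1)
    - P / Q * (Q / P * lam ^ 3)
  = P * Q * ((P + Q - 1) / (P * Q)) ^ 2 * (kappa5 P Q / (P * Q) ^ 2)
    * ((P - 1) * (Q - 1) / (P * Q)) * ((2 * P * Q - P - Q + 1) / (P * Q))).
{ rewrite Dt; unfold lam, kappa5; field; lra. }
assert (D2' : ((P + Q - 1) / (P * Q)) ^ 2 * (2 * P * Q - P - Q + 1)
    * ((P - 1) * (Q - 1) / (P * Q)) <> 0)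
  by (apply Rgt_not_eq, Rlt_gt; positivity).
assert (D3' : P * Q * ((P + Q - 1) / (P * Q)) ^ 2 * (kappa5 P Q / (P * Q) ^ 2)
    * ((P - 1) * (Q - 1) / (P * Q)) * ((2 * P * Q - P - Q + 1) / (P * Q)) <> 0)
  by (apply Rgt_not_eq, Rlt_gt; positivity).
assert (X1 : x1 = s ^ 2 * (P * (2 * P - 1))
             / (Q * (P + Q - 1) * (2 * P * Q - P - Q + 1))
          /\ y1 = s ^ 2 * ((P - 1) ^ 2 * (2 * Q - 1))
             / (P * Q * (P + Q - 1) * (2 * P * Q - P - Q + 1))).
{ destruct (cramer_unique _ _ _ _ _ _ _ _ _ D2 D2' E1 E2) as [-> ->].
  unfold lam, beta, x0, y0; split; field; lra. }
destruct X1 as [-> ->].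
destruct (cramer_unique _ _ _ _ _ _ _ _ _ D3 D3' E3 E4) as [-> ->].
cbv zeta; unfold c3; unfold kappa5 in *; unfold delta1, delta2, delta3, c2,
  kappa1, kappa2, kappa3, kappa4, x0, y0, lam, beta.
split; [|split]; field; repeat split; lra.
Qed.

(** * Summation of the series and conjugacy to [t |-> lam t] *)

Lemma bounded_CV_radius (a : nat -> R) M x :
  (forall n, Rabs (a n) <= M) -> Rabs x < 1 -> Rbar_lt (Rabs x) (CV_radius a).
Proof.
intros Ha Hx; apply Rbar_lt_le_trans with (Finite 1); [exact Hx|].
apply (proj1 (CV_radius_bounded a)).
exists M; intros n; rewrite pow1, Rmult_1_r; apply Ha.
Qed.

Lemma PSeries_dilate (a : nat -> R) l t :
  PSeries a (l * t) = PSeries (fun n => l ^ n * a n) t.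
Proof. apply Series_ext; intros n; rewrite Rpow_mult_distr; ring. Qed.

(** Both components of the invariance equation, cleared of denominators and divided by [- t], have
    this shape. The factor [t] before the product matches the shift from [m] to [S m]. *)
Lemma PSeries_bilinear_relation (y z g : nat -> R) p q M t :
  (forall n, Rabs (y n) <= M) -> (forall n, Rabs (z n) <= M) ->
  (forall n, Rabs (g n) <= M) ->
  p * y 0%nat + q * g 0%nat - z 0%nat = 0 ->
  (forall m, p * y (S m) + q * g (S m) - z (S m) + PS_mult g y m = 0) ->
  Rabs t < 1 ->
  p * PSeries y t + q * PSeries g t - PSeries z t
  + t * (PSeries g t * PSeries y t) = 0.
Proof.
intros Hy Hz Hg E0 E Ht.
assert (Ry := bounded_CV_radius y M t Hy Ht).
assert (Rz := bounded_CV_radius z M t Hz Ht).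
assert (Rg := bounded_CV_radius g M t Hg Ht).
assert (Cy := CV_radius_inside _ _ Ry).
assert (Cz := CV_radius_inside _ _ Rz).
assert (Cg := CV_radius_inside _ _ Rg).
assert (Cm := ex_pseries_mult _ _ _ Rg Ry).
assert (comm : forall a b : R_AbsRing, mult a b = mult b a)
  by (intros; apply Rmult_comm).
rewrite <- PSeries_mult, <- PSeries_incr_1 by assumption.
rewrite <- (PSeries_scal p), <- (PSeries_scal q).
rewrite <- PSeries_plus by (apply ex_pseries_scal; [apply comm|assumption]).
rewrite <- PSeries_minus; [|apply ex_pseries_plus|assumption];
  try (apply ex_pseries_scal; [apply comm|assumption]).
rewrite <- PSeries_plus.
- rewrite <- (PSeries_const_0 t); apply PSeries_ext; intros [|m].
  + unfold PS_plus, PS_minus, PS_scal, PS_incr_1; simpl.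
    unfold plus, minus, opp, scal, zero; simpl; unfold mult; simpl.
    unfold PS_opp, opp; simpl. lra.
  + rewrite <- (E m).
    unfold PS_plus, PS_minus, PS_scal, PS_incr_1; simpl.
    unfold plus, minus, opp, scal; simpl; unfold mult; simpl.
    unfold PS_opp, opp; simpl; ring.
- apply ex_pseries_minus; [apply ex_pseries_plus|assumption];
    apply ex_pseries_scal; try apply comm; assumption.
- apply ex_pseries_incr_1; assumption.
Qed.

Lemma PSeries_taylor3 (a : nat -> R) M t :
  (forall n, Rabs (a n) <= M) -> Rabs t < 1 ->
  PSeries a t = a 0%nat + t * (a 1%nat + t * (a 2%nat
    + t * PSeries (fun n => a (3 + n)%nat) t)).
Proof.
intros Ha Ht.
assert (H : forall k, PSeries (fun n => a (k + n)%nat) t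
  = a k + t * PSeries (fun n => a (S k + n)%nat) t).
{ intros k; rewrite PSeries_decr_1.
  - rewrite Nat.add_0_r; do 2 f_equal; apply PSeries_ext; intros n.
    unfold PS_decr_1; f_equal; lia.
  - apply CV_radius_inside, bounded_CV_radius with M; auto. }
change (PSeries a t) with (PSeries (fun n => a (0 + n)%nat) t).
now rewrite (H 0%nat), (H 1%nat), (H 2%nat).
Qed.

(** The three equations cancel the coefficients of [t], [t^2], [t^3]; what remains is [t^4] times an
    explicit function, continuous and hence bounded near 0. *)
Lemma cubic_contact d1 d2 d3 e2 e3 x0 x1 x2 y0 y1 y2 (X Y : R -> R) :
  ex_derive X 0 -> ex_derive Y 0 ->
  d1 * x0 - d2 * y0 = 0 ->
  d1 * x1 - d2 * y1 + e2 * (d1 * x0 + d3 * y0) ^ 2 = 0 ->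
  d1 * x2 - d2 * y2 + 2 * e2 * (d1 * x0 + d3 * y0) * (d1 * x1 + d3 * y1)
    + e3 * (d1 * x0 + d3 * y0) ^ 3 = 0 ->
  exists M, locally 0 (fun t =>
    let x := t * (x0 + t * (x1 + t * (x2 + t * X t))) in
    let y := t * (y0 + t * (y1 + t * (y2 + t * Y t))) in
    Rabs (d1 * x - d2 * y + e2 * (d1 * x + d3 * y) ^ 2
          + e3 * (d1 * x + d3 * y) ^ 3) <= M * Rabs t ^ 4).
Proof.
intros DX DY E1 E2 E3.
(* The linear form [d1 x + d3 y] equals [t (w0 + t V1)] with [V1 = w1 + t V2]. *)
pose (w0 := d1 * x0 + d3 * y0); pose (w1 := d1 * x1 + d3 * y1).
pose (w2 := d1 * x2 + d3 * y2).
pose (V2 := fun t => w2 + t * (d1 * X t + d3 * Y t)).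
pose (V1 := fun t => w1 + t * V2 t).
pose (rem := fun t => d1 * X t - d2 * Y t
  + e2 * (w1 ^ 2 + 2 * w0 * V2 t + 2 * w1 * t * V2 t + (t * V2 t) ^ 2)
  + e3 * (3 * w0 ^ 2 * V1 t + 3 * w0 * t * V1 t ^ 2 + t ^ 2 * V1 t ^ 3)).
assert (C : continuous rem 0).
{ apply (ex_derive_continuous rem); unfold rem, V1, V2; auto_derive; tauto. }
exists (Rabs (rem 0) + 1).
assert (B : locally 0 (fun t => Rabs (rem t - rem 0) < 1)).
{ destruct (C (ball (rem 0) 1)) as [e He];
    [now exists (mkposreal 1 Rlt_0_1)|].
  exists e; intros t Ht; apply (He t Ht). }
revert B; apply filter_imp; intros t Ht; cbv zeta.
match goal with |- Rabs ?e <= _ => replace e with (rem t * t ^ 4) end.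
- rewrite Rabs_mult, <- RPow_abs.
  apply Rmult_le_compat_r; [apply pow_le, Rabs_pos|].
  replace (rem t) with (rem 0 + (rem t - rem 0)) by ring.
  apply Rle_trans with (1 := Rabs_triang _ _); lra.
- symmetry; unfold rem, V1, V2, w0, w1, w2.
  match goal with |- ?a = ?b => 
  replace a with (b + t * (d1 * x0 - d2 * y0)
   + t ^ 2 * (d1 * x1 - d2 * y1 + e2 * (d1 * x0 + d3 * y0) ^ 2)
   + t ^ 3 * (d1 * x2 - d2 * y2
      + 2 * e2 * (d1 * x0 + d3 * y0) * (d1 * x1 + d3 * y1)
      + e3 * (d1 * x0 + d3 * y0) ^ 3)) by ring end.
  rewrite E1, E2, E3; ring.
Qed.

(** The unit disc comes from convergence alone, so the conjugacy is stated where the denominators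
    [b t] and [a (lam t)] do not vanish; positivity is arranged later by shrinking. *)
Lemma stable_manifold_parametrization (beta P Q : R) :
  0 <= beta -> 1 < P -> 1 < Q -> / P + / Q = 1 - beta ->
  exists (a b : R -> R) (lam c : R), 0 < lam < 1 /\ a 0 = P /\ b 0 = Q
  /\ (forall n, Cn (fun t => Rabs (t - 0) < 1) n a)
  /\ (forall n, Cn (fun t => Rabs (t - 0) < 1) n b)
  /\ 0 < c /\ is_derive a 0 c
  /\ (forall t, Rabs t < 1 -> b t <> 0 -> a (lam * t) <> 0 ->
        T2 beta (a t, b t) = (a (lam * t), b (lam * t)))
  /\ exists M, locally 0 (fun t => Rabs (Cexp P Q (a t) (b t)) <= M * Rabs t ^ 4).
Proof.
intros Hb HP HQ Hbeta.
destruct (manifold_coefficients beta P Q Hb HP HQ Hbeta)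
  as (al & bt & s & Hs & A0 & B0 & HA & HB & E1 & E2).
assert (Hlam := multiplier_bounds P Q HP HQ).
set (lam := (1 - / P) * (1 - / Q)) in *.
assert (Ebeta : beta = 1 - / P - / Q) by lra.
assert (Hbeta1 : beta <= 1).
{ assert (0 < / P) by (apply Rinv_0_lt_compat; lra).
  assert (0 < / Q) by (apply Rinv_0_lt_compat; lra). lra. }
assert (Hpow : forall n, 0 < lam ^ n <= 1).
{ intros n; split; [now apply pow_lt|].
  rewrite <- (pow1 n); apply pow_incr; lra. }
assert (R1 : forall (a : nat -> R), (forall n, Rabs (a n) <= 1) ->
  forall t, Rabs t < 1 -> Rbar_lt (Rabs t) (CV_radius a)).
{ intros a Ha t Ht; now apply bounded_CV_radius with 1. }
pose (a := fun t => P + t * PSeries al t).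
pose (b := fun t => Q + t * PSeries bt t).
exists a, b, lam, (al 0%nat).
assert (Hc : 0 < al 0%nat).
{ rewrite A0; apply Rmult_lt_0_compat; [lra|]; apply Rdiv_lt_0_compat; lra. }
split; [exact Hlam|].
split; [unfold a; ring|]; split; [unfold b; ring|].
split; [|split].
- intros n; apply Cn_plus; [apply Cn_const|].
  apply Cn_mult; [apply Cn_id|]; apply Cn_PSeries.
  intros x Hx; apply R1; [exact HA|]; now rewrite Rminus_0_r in Hx.
- intros n; apply Cn_plus; [apply Cn_const|].
  apply Cn_mult; [apply Cn_id|]; apply Cn_PSeries.
  intros x Hx; apply R1; [exact HB|]; now rewrite Rminus_0_r in Hx.
- assert (Z : forall u, (forall n, Rabs (u n) <= 1) -> ex_derive (PSeries u) 0).
  { intros u Hu; apply ex_derive_PSeries, R1; [exact Hu|].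
    rewrite Rabs_R0; lra. }
  split; [exact Hc|]; split; [|split].
  + unfold a; auto_derive; [now apply Z|].
    rewrite PSeries_0; ring.
  + intros t Ht Hbt Hat.
    (* [g] sums to [(a (lam t) - beta a t - (1 - beta) P) / t], [h] to the same with [b] and [Q],
       and [al'] to [(a (lam t) - P) / t]. *)
    pose (g := fun j => (lam ^ S j - beta) * al j).
    pose (h := fun j => (lam ^ S j - beta) * bt j).
    pose (al' := fun j => lam ^ S j * al j).
    assert (W : forall w u, Rabs w <= 1 -> Rabs u <= 1 -> Rabs (w * u) <= 1).
    { intros w u Hw Hu; rewrite Rabs_mult.
      assert (Pw := Rabs_pos w); assert (Pu := Rabs_pos u); nra. }
    assert (W1 : forall j, Rabs (lam ^ S j - beta) <= 1).
    { intros j; assert (H := Hpow (S j)); apply Rabs_le; lra. }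
    assert (W2 : forall j, Rabs (lam ^ S j) <= 1).
    { intros j; assert (H := Hpow (S j)); apply Rabs_le; lra. }
    assert (Hg : forall n, Rabs (g n) <= 1) by (intros n; now apply W).
    assert (Hh : forall n, Rabs (h n) <= 1) by (intros n; now apply W).
    assert (Hal' : forall n, Rabs (al' n) <= 1) by (intros n; now apply W).
    assert (F1 := PSeries_bilinear_relation bt al g (P / Q) Q 1 t HB HA Hg).
    assert (F2 := PSeries_bilinear_relation al' bt h (Q / P) P 1 t Hal' HB Hh).
    assert (G : forall u, (forall n, Rabs (u n) <= 1) ->
      PSeries (fun j => (lam ^ S j - beta) * u j) t
      = lam * PSeries u (lam * t) - beta * PSeries u t).
    { intros u Hu; rewrite PSeries_dilate, <- !PSeries_scal.
      rewrite <- PSeries_minus.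
      - apply PSeries_ext; intros n; unfold PS_minus, PS_plus, PS_opp, PS_scal.
        unfold plus, opp, scal; simpl; unfold mult; simpl; ring.
      - apply ex_pseries_scal; [apply Rmult_comm|].
        apply CV_radius_inside, R1; [|exact Ht].
        intros n; apply W; auto; assert (H := Hpow n); apply Rabs_le; lra.
      - apply ex_pseries_scal; [apply Rmult_comm|].
        apply CV_radius_inside, R1; assumption. }
    assert (Eal' : PSeries al' t = lam * PSeries al (lam * t)).
    { rewrite PSeries_dilate, <- PSeries_scal; apply PSeries_ext.
      intros n; unfold PS_scal, al', scal; simpl; unfold mult; simpl; ring. }
    unfold g in F1; unfold h in F2.
    rewrite G in F1 by exact HA; rewrite G in F2 by exact HB.
    rewrite Eal' in F2.
    assert (F1' := fun H0 H => F1 H0 H Ht); clear F1.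
    assert (F2' := fun H0 H => F2 H0 H Ht); clear F2.
    (* By this identity the eigenvector satisfies the relations of first order. *)
    assert (L0 : lam - beta = / (P * Q)).
    { unfold lam; rewrite Ebeta; field; lra. }
    specialize (F1' ltac:(rewrite pow_1, L0, A0, B0; field; lra)).
    specialize (F2' ltac:(unfold al'; rewrite !pow_1, L0, A0, B0;
                          unfold lam; field; lra)).
    specialize (F1' ltac:(intros m; assert (H := E1 m); lra)).
    specialize (F2' ltac:(intros m; assert (H := E2 m); unfold al'; lra)).
    (* Multiplied by [b t], the difference of the two sides is [- t] times the left side of
       [F1']. *)
    assert (X : 1 + beta * a t + a t / b t = a (lam * t)).
    { apply Rmult_eq_reg_r with (b t); [|exact Hbt].
      apply Rminus_diag_uniq.
      replace (_ - _) with (a t + (1 + beta * a t - a (lam * t)) * b t)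
        by (field; exact Hbt).
      rewrite <- (Rmult_0_r (- t)), <- F1'; unfold a, b; rewrite Ebeta.
      field; lra. }
    unfold T2, T; cbn [fst snd]; rewrite X; f_equal.
    apply Rmult_eq_reg_r with (a (lam * t)); [|exact Hat].
    apply Rminus_diag_uniq.
    replace (_ - _) with (b t + (1 + beta * b t - b (lam * t)) * a (lam * t))
      by (field; exact Hat).
    rewrite <- (Rmult_0_r (- t)), <- F2'; unfold a, b; rewrite Ebeta.
    field; lra.
  (* Indices 0 and 1 of the recursion are the orders [t^2] and [t^3]. *)
  + assert (J1 := E1 0%nat); assert (J2 := E2 0%nat).
    assert (J3 := E1 1%nat); assert (J4 := E2 1%nat).
    unfold PS_mult in J1, J2, J3, J4; simpl sum_f_R0 in J1, J2, J3, J4.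
    rewrite Ebeta in J1, J2, J3, J4.
    destruct (contact_identities P Q s (al 1%nat) (bt 1%nat) (al 2%nat)
      (bt 2%nat) HP HQ) as [K1 [K2 K3]];
      fold lam; rewrite <- ?A0, <- ?B0.
    * rewrite J1; simpl; ring.
    * rewrite J2; simpl; ring.
    * rewrite J3; simpl; ring.
    * rewrite J4; simpl; ring.
    * rewrite <- A0, <- B0 in K1, K2, K3.
      destruct (cubic_contact _ _ _ _ _ _ _ _ _ _ _
        (PSeries (fun n => al (3 + n)%nat)) (PSeries (fun n => bt (3 + n)%nat))
        (Z _ (fun n => HA _)) (Z _ (fun n => HB _)) K1 K2 K3) as [M HM].
      exists M; generalize (open_Rabs_lt 0 1 0
        ltac:(cbv beta; rewrite Rminus_0_r, Rabs_R0; lra)).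
      revert HM; cbv zeta; intros HM HU.
      generalize (filter_and _ _ HM HU); apply filter_imp.
      intros t [H Ht]; rewrite Rminus_0_r in Ht.
      unfold Cexp, a, b.
      rewrite (PSeries_taylor3 al 1), (PSeries_taylor3 bt 1) by assumption.
      rewrite !(Rplus_comm P), !(Rplus_comm Q), !Rplus_minus_r.
      exact H.
Qed.

(** * The invariant curve as a graph *)

Lemma locally_Rabs (a : R) (A : R -> Prop) :
  locally a A <-> exists e, 0 < e /\ forall x, Rabs (x - a) < e -> A x.
Proof.
split.
- intros [[e He] H]; exists e; split; [exact He|]; intros x Hx; now apply H.
- intros [e [He H]]; exists (mkposreal e He); intros x Hx; now apply H.
Qed.

Lemma continuous_locally_gt (f : R -> R) a c :
  continuous f a -> c < f a -> locally a (fun x => c < f x).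
Proof. intros C H; apply (C (fun y => c < y)); now apply open_gt. Qed.

(** The branch is [b] composed with the inverse of [a]. Invariance is stated for every radius
    [d <= r], so that it survives the shrinking that makes the two curves positive and disjoint. *)
Lemma stable_branch (beta P Q : R) :
  0 <= beta -> 1 < P -> 1 < Q -> / P + / Q = 1 - beta ->
  exists (h : R -> R) (r : R), 0 < r /\ h P = Q
  /\ (forall x, Rabs (x - P) < r -> forall n, ex_derive_n h n x)
  /\ (forall d x, d <= r -> Rabs (x - P) < d ->
        exists x', Rabs (x' - P) < d /\ T2 beta (x, h x) = (x', h x'))
  /\ exists M, locally P (fun x => Rabs (Cexp P Q x (h x)) <= M * Rabs (x - P) ^ 4).
Proof.
intros Hb HP HQ Hbeta.
destruct (stable_manifold_parametrization beta P Q Hb HP HQ Hbeta)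
  as (a & b & lam & c & Hlam & a0 & b0 & Ca & Cb & Hc & Dc & HT & M & HM).
set (U1 := fun t => Rabs (t - 0) < 1) in *.
assert (O1 : open U1) by apply open_Rabs_lt.
assert (U10 : U1 0) by (unfold U1; rewrite Rminus_0_r, Rabs_R0; lra).
destruct (Cn_Derive U1 a O1 Ca) as [Da Ca'].
assert (Ec : Derive a 0 = c) by now apply is_derive_unique.
assert (cont : forall f, (forall n, Cn U1 n f) -> continuous f 0).
{ intros f Cf; apply (ex_derive_continuous f).
  apply (Cn_ex_derive_n U1 1 f 0 O1 (Cf 1%nat) U10). }
assert (L1 := continuous_locally_gt _ 0 (c / 2) (cont _ Ca') ltac:(rewrite Ec; lra)).
assert (L2 := continuous_locally_gt _ 0 0 (cont _ Ca) ltac:(lra)).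
assert (L3 := continuous_locally_gt _ 0 0 (cont _ Cb) ltac:(lra)).
(* One radius on which [a] has derivative above [c / 2], hence an inverse, and on which [a] and [b]
   are positive, so that the conjugacy applies. *)
destruct (proj1 (locally_Rabs _ _) (filter_and _ _ (filter_and _ _ L1 (O1 0 U10))
  (filter_and _ _ L2 L3))) as [r [Hr Hloc]].
assert (Hin : forall t, Rabs t < r ->
  (c / 2 < Derive a t /\ U1 t) /\ 0 < a t /\ 0 < b t).
{ intros t Ht; apply Hloc; now rewrite Rminus_0_r. }
assert (Da' : forall t, Rabs t < r -> is_derive a t (Derive a t))
  by (intros t Ht; apply Da; now apply Hin).
assert (Ba' : forall t, Rabs t < r -> c / 2 <= Derive a t)
  by (intros t Ht; apply Rlt_le; now apply Hin).
destruct (local_inverse a (Derive a) r (c / 2) Hr ltac:(lra) Da' Ba')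
  as (g & rho & Hrho & G1 & G2 & G3 & G4).
rewrite a0 in *.
assert (Emon := is_derive_expanding a (Derive a) r (c / 2) Da' Ba').
exists (fun x => b (g x)), rho; split; [exact Hrho|].
split; [|split; [|split]].
- rewrite <- a0 at 1; rewrite G2, b0; [reflexivity|now rewrite Rabs_R0|].
  now rewrite a0, Rminus_diag, Rabs_R0.
- intros x Hx n.
  apply (Cn_ex_derive_n (fun x => Rabs (x - P) < rho)); [apply open_Rabs_lt| |exact Hx].
  apply Cn_comp_inverse with (U := fun t => Rabs t < r) (f' := Derive a).
  + intros y Hy; now apply G1.
  + intros t Ht; assert (H := Ba' t Ht); lra.
  + exact G4.
  + intros k; apply Cn_subset with U1; [|apply Ca'].
    intros t Ht; now apply Hin.
  + apply Cn_subset with U1; [|apply Cb].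
    intros t Ht; now apply Hin.
- intros d x Hd Hx.
  destruct (G1 x ltac:(lra)) as [F1 F2].
  set (t := g x) in *.
  assert (Hlt : Rabs (lam * t) < r).
  { rewrite Rabs_mult, (Rabs_pos_eq lam) by lra.
    assert (H := Rabs_pos t); nra. }
  assert (R0 : Rabs 0 < r) by (rewrite Rabs_R0; lra).
  (* [a] is increasing and [lam t] lies between 0 and [t], so [a (lam t)] lies between [P] and
     [a t]. *)
  assert (Hd' : Rabs (a (lam * t) - P) <= Rabs (a t - P)).
  { destruct (Rle_or_lt 0 t) as [Hs|Hs].
    - assert (Hu : 0 <= lam * t <= t) by nra.
      revert Hlt Hu; generalize (lam * t); intros u Hlt Hu.
      assert (X1 := Emon 0 u R0 Hlt ltac:(lra)).
      assert (X2 := Emon u t Hlt F1 ltac:(lra)).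
      rewrite a0 in X1; rewrite !Rabs_pos_eq by nra; nra.
    - assert (Hu : t <= lam * t <= 0) by nra.
      revert Hlt Hu; generalize (lam * t); intros u Hlt Hu.
      assert (X1 := Emon u 0 Hlt R0 ltac:(lra)).
      assert (X2 := Emon t u F1 Hlt ltac:(lra)).
      rewrite a0 in X1; rewrite !Rabs_left1 by nra; nra. }
  exists (a (lam * t)); rewrite F2 in Hd'; split; [lra|].
  rewrite G2 by (auto; lra).
  rewrite <- HT, F2; [reflexivity| | |].
  + destruct (Hin _ F1) as [[_ H] _]; unfold U1 in H.
    now rewrite Rminus_0_r in H.
  + apply Rgt_not_eq; now apply Hin.
  + apply Rgt_not_eq; now apply Hin.
- apply locally_Rabs in HM; destruct HM as [e [He HM]].
  (* [|g x| <= |x - P| / (c / 2)] converts the bound in [t^4]; [Rabs M] is taken since the sign of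
     [M] is not known. *)
  exists (Rabs M / (c / 2) ^ 4); apply locally_Rabs.
  exists (Rmin rho (c / 2 * e)); split; [apply Rmin_glb_lt; nra|].
  intros x Hx.
  assert (X1 := Rlt_le_trans _ _ _ Hx (Rmin_l _ _)).
  assert (X2 := Rlt_le_trans _ _ _ Hx (Rmin_r _ _)).
  assert (X3 := G3 x X1); destruct (G1 x X1) as [F1 F2].
  specialize (HM (g x) ltac:(rewrite Rminus_0_r; nra)).
  rewrite F2 in HM; apply Rle_trans with (1 := HM).
  apply Rle_trans with (Rabs M * Rabs (g x) ^ 4).
  { apply Rmult_le_compat_r; [apply pow_le, Rabs_pos|apply Rle_abs]. }
  replace (Rabs M / (c / 2) ^ 4 * Rabs (x - P) ^ 4)
    with (Rabs M * (Rabs (x - P) / (c / 2)) ^ 4) by (field; lra).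
  apply Rmult_le_compat_l; [apply Rabs_pos|].
  apply pow_incr; split; [apply Rabs_pos|].
  apply Rmult_le_reg_l with (c / 2); [lra|].
  replace (c / 2 * (Rabs (x - P) / (c / 2))) with (Rabs (x - P)) by (field; lra).
  exact X3.
Qed.

(* [y |-> Cexp P Q x y] is bi-Lipschitz near [(P, Q)], so a small residual
   forces proximity to the implicit branch. *)
Lemma residual_controls_branch (P Q : R) (h k : R -> R) (n : nat) :
  0 < P + Q - 1 -> 0 < Q -> continuous h P -> continuous k P -> h P = Q -> k P = Q ->
  locally P (fun x => Cexp P Q x (k x) = 0) ->
  (exists M, locally P (fun x => Rabs (Cexp P Q x (h x)) <= M * Rabs (x - P) ^ n)) ->
  eq_upto_O h k P n.
Proof.
intros HPQ HQ Ch Ck hP kP K0 [M HM].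
assert (Hd2 : 0 < delta2 P Q) by (apply Rdiv_lt_0_compat; lra).
pose (w := fun (f : R -> R) x => delta1 P Q * (x - P) + delta3 P Q * (f x - Q)).
(* [- S x] is the divided difference of [Cexp P Q x] between [h x] and [k x]; at [P] the value of
   [S] is [delta2 P Q], which is positive. *)
pose (S := fun x => delta2 P Q - c2 P Q * delta3 P Q * (w h x + w k x)
  - c3 P Q * delta3 P Q * (w h x ^ 2 + w h x * w k x + w k x ^ 2)).
assert (Cw : forall f, continuous f P -> continuous (w f) P).
{ intros f Cf; unfold w; apply (continuous_plus (fun x => delta1 P Q * (x - P))
    (fun x => delta3 P Q * (f x - Q))).
  - apply ex_derive_continuous; auto_derive; exact I.
  - apply (continuous_scal_r (delta3 P Q) (fun x => f x - Q)).
    apply (continuous_minus f (fun _ => Q)); [exact Cf|apply continuous_const]. }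
assert (S0 : S P = delta2 P Q).
{ unfold S, w; rewrite hP, kP; ring. }
assert (CS : continuous S P).
{ assert (C1 := Cw h Ch); assert (C2 := Cw k Ck).
  unfold S; apply (continuous_minus
    (fun x => delta2 P Q - c2 P Q * delta3 P Q * (w h x + w k x))
    (fun x => c3 P Q * delta3 P Q * (w h x ^ 2 + w h x * w k x + w k x ^ 2))).
  - apply (continuous_minus (fun _ => delta2 P Q)
      (fun x => c2 P Q * delta3 P Q * (w h x + w k x)));
      [apply continuous_const|].
    apply (continuous_scal_r (c2 P Q * delta3 P Q) (fun x => w h x + w k x)).
    now apply (continuous_plus (w h) (w k)).
  - apply (continuous_scal_r (c3 P Q * delta3 P Q)
      (fun x => w h x ^ 2 + w h x * w k x + w k x ^ 2)).
    assert (sq : forall f g, continuous f P -> continuous g P ->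
                 continuous (fun x : R => f x * g x) P)
      by (intros f g; apply (continuous_mult f g)).
    apply (continuous_plus (fun x => w h x ^ 2 + w h x * w k x)
      (fun x => w k x ^ 2)).
    + apply (continuous_plus (fun x => w h x ^ 2) (fun x => w h x * w k x)).
      * simpl; apply sq; [|apply sq]; auto using continuous_const.
      * now apply sq.
    + simpl; apply sq; [|apply sq]; auto using continuous_const. }
assert (LS := continuous_locally_gt S P (delta2 P Q / 2) CS ltac:(lra)).
exists (M / (delta2 P Q / 2)).
generalize (filter_and _ _ (filter_and _ _ K0 HM) LS); apply filter_imp.
intros x [[Hk Hh] HS].
assert (E : Cexp P Q x (h x) = - (S x * (h x - k x))).
{ rewrite <- (Rminus_0_r (Cexp P Q x (h x))), <- Hk; unfold Cexp, S, w; ring. }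
rewrite E, Rabs_Ropp, Rabs_mult, (Rabs_pos_eq (S x)) in Hh by lra.
apply Rmult_le_reg_l with (delta2 P Q / 2); [lra|].
replace (delta2 P Q / 2 * (M / (delta2 P Q / 2) * Rabs (x - P) ^ n))
  with (M * Rabs (x - P) ^ n) by (field; lra).
apply Rle_trans with (2 := Hh); apply Rmult_le_compat_r; [apply Rabs_pos|lra].
Qed.

(** * Local curves in the plane and their union *)

Lemma smooth_near_continuous h a : smooth_near h a -> continuous h a.
Proof.
intros H; apply (ex_derive_continuous h).
exact (locally_singleton _ _ H 1%nat).
Qed.

Lemma graph_is_curve (h : R -> R) (a d : R) :
  0 < d -> (forall x, Rabs (x - a) < d -> continuous h x) ->
  is_curve (fun p => Rabs (fst p - a) < d /\ snd p = h (fst p)).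
Proof.
intros Hd Ch.
exists (fun x => Rabs (x - a) < d), (fun x => (x, h x)).
split; [|split; [|split; [|split]]].
- intros x y z Hx Hy Hz; apply Rabs_lt_between in Hx; apply Rabs_lt_between in Hy.
  apply Rabs_lt_between; lra.
- exists a, (a + d / 2); rewrite Rminus_diag, Rabs_R0; repeat split; try lra.
  apply Rabs_lt_between; lra.
- apply continuous_on_forall; intros x Hx.
  apply (continuous_comp_2 (fun x => x) h (fun x y => (x, y)));
    [apply continuous_id|now apply Ch|].
  apply continuous_ext with (fun p => p); [now intros [u v]|apply continuous_id].
- intros s t _ _ E; now injection E.
- intros [x y]; cbn [fst snd]; split.
  + intros [H ->]; now exists x.
  + intros [t [H E]]; injection E; intros -> ->; auto.
Qed.

Lemma locally_fst_Rabs (p0 : R * R) (d : R) (A : R * R -> Prop) :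
  0 < d -> (forall p, Rabs (fst p - fst p0) < d -> A p) -> locally p0 A.
Proof.
intros Hd H; exists (mkposreal d Hd); intros p [Hp _]; apply H, Hp.
Qed.

Lemma locally_pos_quadrant (h : R -> R) a :
  0 < a -> continuous h a -> 0 < h a ->
  exists e, 0 < e /\ forall x, Rabs (x - a) < e -> 0 < x /\ 0 < h x.
Proof.
intros Ha Ch Hh; apply locally_Rabs, filter_and.
- now apply open_gt.
- now apply continuous_locally_gt.
Qed.

Theorem theorem3p1 (beta Phi Psi : R)
  (hbeta : 0 <= beta < 1)
  (hPhi : 1 / (1 - beta) < Phi)
  (hPsi : Psi = Phi / ((1 - beta) * Phi - 1))
  (hne : Phi <> Psi)
  (htPhi htPsi : R -> R)
  (hhtPhi : implicit_branch Phi Psi htPhi)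
  (hhtPsi : implicit_branch Psi Phi htPsi) :
  exists (C1 C2 : R * R -> Prop) (h1 h2 : R -> R),
    is_curve C1 /\ is_curve C2
    /\ (forall p, union C1 C2 p -> pos_quadrant p)
    /\ invariant (T2 beta) (union C1 C2)
    /\ (smooth_near h1 Phi
        /\ graph_near C1 (Phi, Psi) h1
        /\ graph_near (union C1 C2) (Phi, Psi) h1
        /\ eq_upto_O h1 htPhi Phi 4)
    /\ (smooth_near h2 Psi
        /\ graph_near C2 (Psi, Phi) h2
        /\ graph_near (union C1 C2) (Psi, Phi) h2
        /\ eq_upto_O h2 htPsi Psi 4).
Proof.
assert (HP : 1 < Phi).
{ apply Rle_lt_trans with (2 := hPhi); unfold Rdiv; rewrite Rmult_1_l.
  rewrite <- Rinv_1 at 1; apply Rinv_le_contravar; lra. }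
assert (D : 0 < (1 - beta) * Phi - 1).
{ apply Rmult_lt_compat_l with (r := 1 - beta) in hPhi; [|lra].
  replace ((1 - beta) * (1 / (1 - beta))) with 1 in hPhi by (field; lra); lra. }
assert (HQ : 1 < Psi).
{ rewrite hPsi; apply Rmult_lt_reg_r with ((1 - beta) * Phi - 1); [exact D|].
  replace (Phi / _ * _) with Phi by (field; lra); nra. }
(* This relation is symmetric in [Phi] and [Psi], so one construction serves both points of the
   orbit. *)
assert (E : / Phi + / Psi = 1 - beta) by (rewrite hPsi; field; lra).
clear hPsi hPhi D.
destruct (stable_branch beta Phi Psi) as (h1 & r1 & Hr1 & V1 & S1 & I1 & O1);
  try lra.
destruct (stable_branch beta Psi Phi) as (h2 & r2 & Hr2 & V2 & S2 & I2 & O2);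
  try lra.
destruct hhtPhi as (T1 & W1 & Z1), hhtPsi as (T2' & W2 & Z2).
assert (N1 : smooth_near h1 Phi) by (apply locally_Rabs; now exists r1).
assert (N2 : smooth_near h2 Psi) by (apply locally_Rabs; now exists r2).
assert (C1 := smooth_near_continuous _ _ N1).
assert (C2 := smooth_near_continuous _ _ N2).
destruct (locally_pos_quadrant h1 Phi) as (e1 & He1 & Q1); try lra; auto.
destruct (locally_pos_quadrant h2 Psi) as (e2 & He2 & Q2); try lra; auto.
assert (Hdist : 0 < Rabs (Phi - Psi)) by (apply Rabs_pos_lt; lra).
(* A common radius: [r1], [r2] for invariance, [e1], [e2] for positivity, and half the distance of
   [Phi] and [Psi] to keep the vertical strips disjoint. *)
assert (Hd : exists d, 0 < d /\ d <= r1 /\ d <= r2 /\ d <= e1 /\ d <= e2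
                       /\ 2 * d <= Rabs (Phi - Psi)).
{ exists (Rmin (Rmin r1 r2) (Rmin (Rmin e1 e2) (Rabs (Phi - Psi) / 2))).
  unfold Rmin; repeat destruct Rle_dec; lra. }
destruct Hd as (d & Hd & D1 & D2 & D3 & D4 & D5).
assert (apart : forall x, Rabs (x - Phi) < d -> Rabs (x - Psi) < d -> False).
{ intros x X1 X2; rewrite Rabs_minus_sym in X1.
  assert (X := Rabs_triang (Phi - x) (x - Psi)).
  replace (Phi - x + (x - Psi)) with (Phi - Psi) in X by ring; lra. }
pose (K1 := fun p : R * R => Rabs (fst p - Phi) < d /\ snd p = h1 (fst p)).
pose (K2 := fun p : R * R => Rabs (fst p - Psi) < d /\ snd p = h2 (fst p)).
exists K1, K2, h1, h2.
split; [|split; [|split; [|split; [|split]]]].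
- apply graph_is_curve; [exact Hd|]; intros x Hx.
  apply (ex_derive_continuous h1); apply (S1 x ltac:(lra) 1%nat).
- apply graph_is_curve; [exact Hd|]; intros x Hx.
  apply (ex_derive_continuous h2); apply (S2 x ltac:(lra) 1%nat).
- intros p [[Hp Ep]|[Hp Ep]]; unfold pos_quadrant; rewrite Ep;
    [apply Q1|apply Q2]; lra.
- intros [x y] [[Hp Ep]|[Hp Ep]]; cbn [fst snd] in Hp, Ep; rewrite Ep.
  + destruct (I1 d x D1 Hp) as (x' & Hx' & ->); left; split; auto.
  + destruct (I2 d x D2 Hp) as (x' & Hx' & ->); right; split; auto.
- split; [exact N1|]; split; [|split].
  + apply locally_fst_Rabs with d; [exact Hd|]; intros p Hp; unfold K1; tauto.
  (* [K2] has no point in the strip over [Phi], so the union coincides with [K1] there. *)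
  + apply locally_fst_Rabs with d; [exact Hd|]; intros p Hp; unfold union, K1, K2.
    assert (A := apart _ Hp); cbn [fst] in *; tauto.
  + apply residual_controls_branch with Psi; auto using smooth_near_continuous; lra.
- split; [exact N2|]; split; [|split].
  + apply locally_fst_Rabs with d; [exact Hd|]; intros p Hp; unfold K2; tauto.
  + apply locally_fst_Rabs with d; [exact Hd|]; intros p Hp; unfold union, K1, K2.
    assert (A := fun H => apart _ H Hp); cbn [fst] in *; tauto.
  + apply residual_controls_branch with Phi; auto using smooth_near_continuous; lra.
Qed.
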